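(* Let $G=(V,E)$ be a Gaussian tree. Let $a\neq c$ be two vertices of $G$ and let $Z_1,Z_2\subseteq V\setminus\{a,c\}$ be such that $\{a,c\}\perp\!\!\!\perp Z_2\mid Z_1$. Then $$\rho^2_{ac\mid Z_1}\le\rho^2_{ac\mid Z_2}.$$
   Context: A Gaussian tree is a finite undirected tree $G=(V,E)$ together with a Gaussian random vector indexed by $V$ (also denoted $V$), $V\sim N(\mu,\Sigma)$ with $\Sigma$ positive definite, such that for pairwise disjoint $T_1,T_2,T_3\subseteq V$, $T_1$ and $T_2$ are conditionally independent given $T_3$ whenever $T_3$ separates $T_1$ from $T_2$ in $G$, i.e. every path from a vertex of $T_1$ to a vertex of $T_2$ intersects $T_3$. (The converse is not assumed: conditional independence may also hold because of the parameter values.) $X\perp\!\!\!\perp Y\mid W$ denotes conditional independence under the Gaussian distribution, equivalently $\Sigma_{XY}-\Sigma_{XW}\Sigma_{WW}^{-1}\Sigma_{WY}=0$. For distinct $u,v$ and $Z\subseteq V\setminus\{u,v\}$ the squared partial correlation is $$\rho^2_{uv\mid Z}=\frac{(\sigma_{uv}-\Sigma_{uZ}\Sigma_{ZZ}^{-1}\Sigma_{Zv})^2}{(\sigma_{uu}-\Sigma_{uZ}\Sigma_{ZZ}^{-1}\Sigma_{Zu})(\sigma_{vv}-\Sigma_{vZ}\Sigma_{ZZ}^{-1}\Sigma_{Zv})},$$ where $\sigma_{uv}$ is the $(u,v)$ entry of $\Sigma$ and $\Sigma_{uZ}$ etc. are submatrices; for $Z=\emptyset$ the correction terms are absent. *)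

(* Defs.v *)
From mathcomp Require Import all_boot all_order all_algebra.
From mathcomp Require Import reals.

Set Implicit Arguments.
Unset Strict Implicit.
Unset Printing Implicit Defensive.

Import Order.TTheory GRing.Theory Num.Theory.
Local Open Scope ring_scope.

Section Tree.
Variables (V : finType) (e : rel V).

(* A two-vertex ucycle merely walks an edge back and forth, so graph cycles   *)
(* are the ucycles of length at least 3.                                      *)
Definition is_tree : Prop :=
  [/\ symmetric e, irreflexive e, forall x y, connect e x y
    & forall s : seq V, (2 < size s)%N -> ~ ucycle e s].

(* [x :: p] lists the vertices of a path, endpoints included; p = [::] is     *)
(* allowed.                                                                   *)
Definition separates (T3 T1 T2 : {set V}) : Prop :=
  forall (x : V) (p : seq V), x \in T1 -> last x p \in T2 ->
    path e x p -> uniq (x :: p) -> exists2 z, z \in x :: p & z \in T3.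

End Tree.

Section Covariance.
Variables (R : realType) (V : finType) (S : V -> V -> R).

Definition posdef : Prop :=
  (forall u v, S u v = S v u) /\
  (forall x : V -> R, (exists v, x v != 0) ->
     0 < \sum_u \sum_v x u * S u v * x v).

Definition submat (A B : {set V}) : 'M[R]_(#|A|, #|B|) :=
  \matrix_(i, j) S (enum_val i) (enum_val j).

Definition cond_covmx (A B W : {set V}) : 'M[R]_(#|A|, #|B|) :=
  submat A B - submat A W *m invmx (submat W W) *m submat W B.

(* Conditional independence of the coordinates in A and B given those in W,   *)
(* for a Gaussian vector with covariance S; the sets may overlap.             *)
Definition cond_indep (A B W : {set V}) : Prop := cond_covmx A B W = 0.

(* For Z = set0 the matrices have a zero dimension and the correction is 0.   *)
Definition cond_cov (u v : V) (Z : {set V}) : R :=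
  S u v - ((\row_j S u (enum_val j)) *m invmx (submat Z Z)
           *m (\col_i S (enum_val i) v)) 0 0.

Definition rho2 (u v : V) (Z : {set V}) : R :=
  cond_cov u v Z ^+ 2 / (cond_cov u u Z * cond_cov v v Z).

Lemma cond_covmxE (A B W : {set V}) i j :
  cond_covmx A B W i j = cond_cov (enum_val i) (enum_val j) W.
Proof.
rewrite /cond_covmx /cond_cov !mxE; congr (_ - _).
apply: eq_bigr => k _; rewrite !mxE; congr (_ * _).
by apply: eq_bigr => l _; rewrite !mxE.
Qed.

Lemma cond_cov0 u v : cond_cov u v set0 = S u v.
Proof.
rewrite /cond_cov mxE big1 ?subr0 // => i _.
by exfalso; case: i => m; rewrite cards0.
Qed.

End Covariance.

(* The Gaussian vector enters through the parameters of its law N(mean, cov). *)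
Record gaussian_tree (R : realType) (V : finType) := GaussianTree {
  edge : rel V;
  mean : V -> R;
  cov : V -> V -> R;
  edge_tree : is_tree edge;
  cov_posdef : posdef cov;
  markov : forall T1 T2 T3 : {set V},
    [disjoint T1 & T2] -> [disjoint T1 & T3] -> [disjoint T2 & T3] ->
    separates edge T3 T1 T2 -> cond_indep cov T1 T2 T3
}.

(* Main.v *)
Require Import Defs.
From mathcomp Require Import all_boot all_order all_algebra.
From mathcomp Require Import reals.
From mathcomp Require Import ring.

Import Order.TTheory GRing.Theory Num.Theory.
Local Open Scope ring_scope.

(* In a tree, enlarging the conditioning set never increases the squared      *)
(* partial correlation of a and c. Indeed, add one vertex b at a time and let *)
(* m be the median of a, b and c. If m already belongs to Z, then a, b, c are *)
(* pairwise uncorrelated given Z. Otherwise, given Z, the correlations        *)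
(* factor through m: r_ac = xz, r_ab = xy and r_bc = yz, so that the new      *)
(* squared correlation is                                                     *)
(*   x^2 z^2 (1 - y^2)^2 / ((1 - x^2 y^2) (1 - y^2 z^2)) <= x^2 z^2.          *)
(* Independence of {a, c} and Z2 given Z1 makes rho2 at Z1 equal to rho2 at   *)
(* Z1 :|: Z2, to which the monotonicity from Z2 applies.                      *)

(** The shape of the graph enters only through [tree_median]: a single vertex m lies on all three
    paths between a, b and c. The linear algebra is condensed into [cond_covU1], the update rule for
    conditioning on one more vertex. If m is outside Z, the Markov property annihilates the
    covariances once m is added, and the update rule read backwards gives the factorization through
    m, [cond_cov_median]. What remains is the real inequality [partial_corr_le]; [rho2_setU1]
    combines these for one vertex, [rho2_setU] iterates, and [cond_cov_setU] exploits the
    independence hypothesis. *)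

Section TreePaths.
Set Implicit Arguments.
Unset Strict Implicit.
Variables (V : finType) (e : rel V).
Hypothesis tree_e : is_tree e.

Lemma tree_upath_uniq (x : V) (p q : seq V) :
  path e x p -> uniq (x :: p) -> path e x q -> uniq (x :: q) ->
  last x p = last x q -> p = q.
Proof.
case: tree_e => sym_e _ _ acyc.
elim: p x q => [|y p IH] x [|z q] //=.
- move=> _ _ _ /andP[xq _] xE.
  by move: (mem_last z q); rewrite -xE (negPf xq).
- move=> _ /andP[xp _] _ _ xE.
  by move: (mem_last y p); rewrite xE (negPf xp).
move=> /andP[exy yp] /andP[xp up] /andP[exz zq] /andP[xq uq] lastE.
have [yz|yz] := eqVneq y z; first by subst z; rewrite (IH y q).
(* otherwise a walk from y to z that avoids x closes to a cycle through x *)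
pose w := p ++ rev (belast z q).
have pw : path e y w.
  rewrite cat_path yp lastE rev_path /=.
  by rewrite (eq_path (e' := e)) // => u v; rewrite sym_e.
have lw : last y w = z.
  rewrite last_cat lastE; case: (q) => [|t q'] //=.
  by rewrite rev_cons last_rcons.
have xw : x \notin y :: w.
  move: xp xq; rewrite !in_cons mem_cat mem_rev !negb_or => /andP[-> ->] /=.
  move=> /andP[xz xq]; apply/negP => /mem_belast.
  by rewrite in_cons (negPf xz) (negPf xq).
case: (shortenP pw) lw => s ps us sub_sw ls.
exfalso; apply: (acyc [:: x, y & s]).
  (* An empty [s] would give y = z, so the cycle has at least three vertices. *)
  by case: s ls {ps us sub_sw} => //= yE; rewrite yE eqxx in yz.
rewrite /ucycle /= rcons_path exy ps ls sym_e exz /=.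
move: xw us; rewrite !in_cons !negb_or => /andP[-> xw] /= ->.
by rewrite andbT; apply/negP => /sub_sw; rewrite (negPf xw).
Qed.

(** The given simple path is the only one between its ends, so each of its vertices is a cut. *)
Lemma tree_upath_separates (x : V) (p : seq V) (m : V) (T : {set V}) :
  path e x p -> uniq (x :: p) -> m \in x :: p -> m \in T ->
  separates e T [set x] [set last x p].
Proof.
move=> pp up mp mT y q; rewrite !inE => /eqP-> /eqP lq pq uq.
by exists m => //; rewrite (tree_upath_uniq pq uq pp up lq).
Qed.

Lemma tree_upath_exists (x y : V) :
  exists2 p, path e x p & uniq (x :: p) /\ last x p = y.
Proof.
case: tree_e => _ _ conn _; have /connectP[p pp ->] := conn x y.
by case: (shortenP pp) => q pq uq _; exists q.
Qed.

(** Cuts a path at its first vertex in [A]; the inclusion in [p] is what keeps the path simple in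
    the induction. *)
Lemma first_hit (x : V) (p : seq V) (A : {pred V}) :
  path e x p -> uniq (x :: p) -> last x p \in A ->
  exists q, [/\ path e x q, uniq (x :: q), last x q \in A,
    {in belast x q, forall z, z \notin A} & {subset q <= p}].
Proof.
elim: p x => [|y p IH] x /=; first by exists [::].
have [xA _ _ _|xA /andP[exy yp] /andP[xp up] lA] := boolP (x \in A).
  by exists [::].
have [q [pq uq lq hq sqp]] := IH y yp up lA.
have syq : {subset y :: q <= y :: p}.
  by move=> z; rewrite !in_cons => /orP[->//|/sqp->]; rewrite orbT.
exists (y :: q); split=> //; first by rewrite /= exy.
- by rewrite cons_uniq; apply/andP; split=> //; apply/negP => /syq; apply/negP.
by move=> z; rewrite in_cons => /orP[/eqP->|/hq].
Qed.

Lemma separates_sym (T A B : {set V}) :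
  symmetric e -> separates e T A B -> separates e T B A.
Proof.
move=> sym_e sep x p xB lA pp up.
have revE : rev (x :: p) = last x p :: rev (belast x p).
  by rewrite lastI rev_rcons.
have lE : last (last x p) (rev (belast x p)) = x.
  by case: (p) => //= t q; rewrite rev_cons last_rcons.
have [||||z] := sep (last x p) (rev (belast x p)) => //.
- by rewrite lE.
- by rewrite rev_path (eq_path (e' := e)) // => u v; rewrite sym_e.
- by rewrite -revE rev_uniq.
by rewrite -revE mem_rev; exists z.
Qed.

(** Two simple paths that share only their junction concatenate to a simple path, on which the
    junction lies. *)
Lemma tree_cat_separates (x : V) (p q : seq V) (T : {set V}) :
  path e x p -> uniq (x :: p) ->
  path e (last x p) q -> uniq (last x p :: q) ->
  {in belast x p, forall z, z \notin last x p :: q} -> last x p \in T ->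
  separates e T [set x] [set last (last x p) q].
Proof.
move=> pp up pq uq dpq mT; rewrite -last_cat.
apply: (tree_upath_separates (m := last x p)) => //.
- by rewrite cat_path pp.
- rewrite -cat_cons lastI cat_rcons cat_uniq uq andbT.
  apply/andP; split; first by move: up; rewrite lastI rcons_uniq => /andP[].
  by apply/hasPn => z zq; apply/negP => /dpq; rewrite zq.
by rewrite -cat_cons mem_cat mem_last.
Qed.

(** The median is the first vertex at which the path from b to a meets the path from a to c.
    Quantifying over every [T] that contains it serves both Z itself and m added to Z. *)
Lemma tree_median (a b c : V) : exists m, forall T : {set V}, m \in T ->
  [/\ separates e T [set a] [set b], separates e T [set a] [set c]
    & separates e T [set b] [set c]].
Proof.
have [sym_e _ _ _] := tree_e.
have [p pp [up pc]] := tree_upath_exists a c.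
have [q0 pq0 [uq0 q0a]] := tree_upath_exists b a.
have [|q [pq uq mq hq _]] := first_hit (A := mem (a :: p)) pq0 uq0.
  by rewrite q0a; apply: mem_head.
have {}mq : last b q \in a :: p := mq.
exists (last b q) => T mT.
split; last first.
(* From b to c: go to the median, then follow the second half of the path from a to c. *)
- move: pc pp up hq.
  case/splitPl: mq => p1 p2 lp1.
  rewrite -cat_cons last_cat cat_path lp1 cat_uniq => <- /andP[pp1 pp2].
  move=> /and3P[up1 dp up2] hq.
  have mp2 : {subset last b q :: p2 <= (a :: p1) ++ p2}.
    move=> z; rewrite in_cons mem_cat => /orP[/eqP->|->]; last by rewrite orbT.
    by rewrite -lp1 mem_last.
  apply: tree_cat_separates => //.
  + rewrite cons_uniq up2 andbT; apply/negP => mp.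
    by move/hasPn: dp => /(_ _ mp); rewrite -lp1 mem_last.
  + by move=> z /hq; apply: contraNN; apply: mp2.
- by rewrite -pc; apply: tree_upath_separates mT.
(* From b to a: go to the median, then follow the first half of that path backwards. *)
apply: separates_sym => //.
move: pp up hq.
case/splitPl: mq => p1 p2 lp1.
rewrite cat_path lp1 -cat_cons cat_uniq => /andP[pp1 _].
move=> /and3P[up1 _ _] hq.
have revE : last b q :: rev (belast a p1) = rev (a :: p1).
  by rewrite -lp1 -rev_rcons -lastI.
have -> : a = last (last b q) (rev (belast a p1)).
  by case: (p1) lp1 => //= t r _; rewrite rev_cons last_rcons.
apply: tree_cat_separates => //.
- by rewrite -lp1 rev_path (eq_path (e' := e)) // => u v; rewrite sym_e.
- by rewrite revE rev_uniq.
- move=> z /hq; apply: contraNN; rewrite revE mem_rev => zp.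
  by rewrite -[_ \in _]/(z \in a :: (p1 ++ p2)) -cat_cons mem_cat zp.
Qed.

End TreePaths.

(** * Conditional covariances through regression residuals *)

Section ConditionalCovariance.
Set Implicit Arguments.
Unset Strict Implicit.
Variables (R : realType) (V : finType) (S : V -> V -> R).
Hypothesis pdS : posdef S.

(* The coefficients x of the residual \sum_k x k * X_k left by the regression *)
(* of X_u on (X_z), z in Z.                                                   *)
Definition residual (u : V) (Z : {set V}) (x : V -> R) : Prop :=
  {in [predC Z], forall k, x k = (k == u)%:R} /\
  {in Z, forall z, \sum_k x k * S k z = 0}.

Definition extend0 (Z : {set V}) (w : 'rV[R]_#|Z|) (k : V) : R :=
  \sum_i w 0 i * (enum_val i == k)%:R.

Lemma extend0_out (Z : {set V}) (w : 'rV_#|Z|) k :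
  k \notin Z -> extend0 w k = 0.
Proof.
move=> kZ; apply: big1 => i _; case: eqP => [ik|_]; last by rewrite mulr0.
by rewrite -ik enum_valP in kZ.
Qed.

Lemma extend0_val (Z : {set V}) (w : 'rV_#|Z|) i :
  extend0 w (enum_val i) = w 0 i.
Proof.
rewrite /extend0 (bigD1 i) //= eqxx mulr1 big1 ?addr0 // => j ji.
by rewrite (inj_eq enum_val_inj) (negPf ji) mulr0.
Qed.

Lemma sum_extend0 (Z : {set V}) (w : 'rV_#|Z|) (f : V -> R) :
  \sum_k extend0 w k * f k = \sum_i w 0 i * f (enum_val i).
Proof.
under eq_bigr do rewrite mulr_suml.
rewrite exchange_big; apply: eq_bigr => i _ /=.
rewrite (bigD1 (enum_val i)) //= eqxx mulr1 big1 ?addr0 // => k ki.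
by rewrite eq_sym (negPf ki) mulr0 mul0r.
Qed.

(** The quadratic form vanishes at such an [x]. This yields both the invertibility of principal
    submatrices and the uniqueness of residuals. *)
Lemma posdef_eq0 (x : V -> R) :
  (forall v, x v != 0 -> \sum_k x k * S k v = 0) -> forall v, x v = 0.
Proof.
move=> xS v; apply/eqP; apply/negPn/negP => xv.
have := pdS.2 x (ex_intro _ v xv).
rewrite exchange_big big1 ?ltxx // => k _; rewrite -mulr_suml.
by have [->|/xS->] := eqVneq (x k) 0; rewrite ?mulr0 ?mul0r.
Qed.

Lemma submat_unit (Z : {set V}) : submat S Z Z \in unitmx.
Proof.
rewrite -row_free_unit; apply: inj_row_free => w wS.
have w0 : forall v, extend0 w v = 0.
  apply: posdef_eq0 => v; have [vZ _|vZ] := boolP (v \in Z); last first.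
    by rewrite extend0_out ?eqxx.
  rewrite (sum_extend0 w (S^~ v)) -(enum_rankK_in vZ vZ).
  move/rowP: wS => /(_ (enum_rank_in vZ v)); rewrite !mxE => wS.
  by rewrite -[RHS]wS; apply: eq_bigr => i _; rewrite mxE.
by apply/rowP => i; rewrite mxE -extend0_val.
Qed.

(** Subtract from the unit vector at u the regression coefficients; the normal equations on Z hold
    by construction. Later arguments work with residuals instead of inverse matrices. *)
Lemma residual_exists (u : V) (Z : {set V}) : exists2 x, residual u Z x &
  forall v, cond_cov S u v Z = \sum_k x k * S k v.
Proof.
pose w := (\row_j S u (enum_val j)) *m invmx (submat S Z Z).
pose x k := (k == u)%:R - extend0 w k.
have xS v : \sum_k x k * S k v = S u v - \sum_i w 0 i * S (enum_val i) v.
  rewrite -(sum_extend0 w (S^~ v)).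
  under eq_bigr do rewrite mulrBl.
  rewrite sumrB; congr (_ - _); rewrite (bigD1 u) //= eqxx mul1r.
  by rewrite big1 ?addr0 // => k /negPf->; rewrite mul0r.
exists x; last first.
  move=> v; rewrite xS /cond_cov -/w; congr (_ - _).
  by rewrite mxE; apply: eq_bigr => i _; rewrite [X in _ * X = _]mxE.
split=> [k|z zZ]; first by rewrite inE => kZ; rewrite /x extend0_out ?subr0.
rewrite xS; apply/eqP; rewrite subr_eq0; apply/eqP.
have := mulmxKV (submat_unit Z) (\row_j S u (enum_val j)).
move/rowP/(_ (enum_rank_in zZ z)); rewrite -/w !mxE enum_rankK_in // => <-.
by apply: eq_bigr => i _; rewrite [X in _ * X = _]mxE enum_rankK_in.
Qed.

(** Two residuals differ by a vector supported on Z and uncorrelated with Z, hence by 0. So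
    exhibiting any residual computes the conditional covariance. *)
Lemma cond_cov_residual u Z x : residual u Z x ->
  forall v, cond_cov S u v Z = \sum_k x k * S k v.
Proof.
move=> [xC xZ] v; have [y [yC yZ] ->] := residual_exists u Z.
apply: eq_bigr => k _; congr (_ * _); apply/eqP; rewrite -subr_eq0; apply/eqP.
move: k; apply: (@posdef_eq0 (fun k => y k - x k)) => k yx.
have kZ : k \in Z.
  by apply: contraNT yx => kZ; rewrite xC ?yC ?subrr // inE.
by under eq_bigr do rewrite mulrBl; rewrite sumrB xZ ?yZ ?subrr.
Qed.

Lemma cond_cov_eq0 u (Z : {set V}) v : v \in Z -> cond_cov S u v Z = 0.
Proof. by move=> vZ; have [x [_ xZ] ->] := residual_exists u Z; apply: xZ. Qed.

(** The residual of u is uncorrelated with Z, so only the coefficient of [y] at v survives. Symmetry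
    and positivity follow from this form. *)
Lemma cond_cov_form u v Z x y : residual u Z x -> residual v Z y ->
  cond_cov S u v Z = \sum_i \sum_j x i * S i j * y j.
Proof.
move=> xr [yC yZ]; rewrite exchange_big /=.
under eq_bigr do rewrite -mulr_suml -(cond_cov_residual xr).
rewrite (bigID [in Z]) /= big1 ?add0r => [|j jZ]; last first.
  by rewrite cond_cov_eq0 ?mul0r.
have [vZ|vZ] := boolP (v \in Z).
  rewrite cond_cov_eq0 // big1 // => j jZ; rewrite yC ?inE //.
  by case: eqP jZ => [->|_]; rewrite ?vZ // mulr0.
rewrite (bigD1 v) //= big1 ?addr0 => [|j /andP[jZ /negPf jv]].
  by rewrite yC ?inE // eqxx mulr1.
by rewrite yC ?inE // jv mulr0.
Qed.

Lemma cond_covC u v Z : cond_cov S u v Z = cond_cov S v u Z.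
Proof.
have [x xr _] := residual_exists u Z; have [y yr _] := residual_exists v Z.
rewrite (cond_cov_form xr yr) (cond_cov_form yr xr) exchange_big.
apply: eq_bigr => j _; apply: eq_bigr => i _.
by rewrite (pdS.1 i j) mulrC mulrA mulrAC.
Qed.

Lemma cond_cov_gt0 u (Z : {set V}) : u \notin Z -> 0 < cond_cov S u u Z.
Proof.
move=> uZ; have [x xr _] := residual_exists u Z.
rewrite (cond_cov_form xr xr); apply: pdS.2; exists u.
by rewrite xr.1 ?inE // eqxx oner_neq0.
Qed.

Lemma cond_cov_ge0 u Z : 0 <= cond_cov S u u Z.
Proof.
have [uZ|/cond_cov_gt0/ltW//] := boolP (u \in Z).
by rewrite cond_cov_eq0.
Qed.

(** Subtracting t times the residual of m from that of u, with t chosen to kill the covariance with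
    m, gives the residual for the larger set. *)
Lemma cond_covU1 m (Z : {set V}) u v : m \notin Z ->
  cond_cov S u v (m |: Z) =
  cond_cov S u v Z - cond_cov S u m Z * cond_cov S m v Z / cond_cov S m m Z.
Proof.
move=> mZ; have mm := lt0r_neq0 (cond_cov_gt0 mZ).
have [x [xC xZ] xE] := residual_exists u Z.
have [y [yC yZ] yE] := residual_exists m Z.
pose t := cond_cov S u m Z / cond_cov S m m Z.
have tE w : \sum_k (x k - t * y k) * S k w =
    cond_cov S u w Z - t * cond_cov S m w Z.
  rewrite xE yE mulr_sumr -sumrB; apply: eq_bigr => k _.
  by rewrite mulrBl mulrA.
rewrite (@cond_cov_residual u (m |: Z) (fun k => x k - t * y k)) ?tE.
  by rewrite /t mulrAC.
split=> [k|z].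
  rewrite !inE negb_or => /andP[/negPf km kZ].
  by rewrite xC ?yC ?inE // km mulr0 subr0.
rewrite !inE tE => /orP[/eqP->|zZ]; first by rewrite /t divfK ?subrr.
by rewrite !cond_cov_eq0 // mulr0 subrr.
Qed.

(** The residual of u given Z is already its residual given the union. *)
Lemma cond_cov_setU u v (Z W : {set V}) :
  {in W, forall w, cond_cov S u w Z = 0} ->
  cond_cov S u v (Z :|: W) = cond_cov S u v Z.
Proof.
move=> uW; have [x [xC xZ] xE] := residual_exists u Z.
rewrite xE (@cond_cov_residual u _ x) //.
split=> [k|z]; first by rewrite !inE negb_or => /andP[kZ _]; apply: xC.
by rewrite inE => /orP[/xZ//|zW]; rewrite -xE uW.
Qed.

Lemma cond_indepP (A B W : {set V}) :
  cond_indep S A B W <->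
  {in A & B, forall u v, cond_cov S u v W = 0}.
Proof.
split=> [AB u v uA vB|AB].
  move/matrixP: AB => /(_ (enum_rank_in uA u) (enum_rank_in vB v)).
  by rewrite cond_covmxE !enum_rankK_in // mxE.
by apply/matrixP => i j; rewrite cond_covmxE mxE AB ?enum_valP.
Qed.

End ConditionalCovariance.

(** * Monotonicity of the squared partial correlation *)

Section Monotonicity.
Set Implicit Arguments.
Unset Strict Implicit.
Variables (R : realType) (V : finType) (G : gaussian_tree R V).
Let S := cov G.
Let pdS : posdef S := cov_posdef G.

Lemma cond_cov_separated (Z : {set V}) u v :
  separates (edge G) Z [set u] [set v] ->
  u != v -> u \notin Z -> v \notin Z -> cond_cov S u v Z = 0.
Proof.
move=> sep uv uZ vZ.
have ind : cond_indep S [set u] [set v] Z.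
  by apply: markov sep; rewrite disjoints1 ?inE.
by move/cond_indepP: ind => -> //; rewrite inE.
Qed.

Lemma cond_cov_median (Z : {set V}) m u v :
  (forall T : {set V}, m \in T -> separates (edge G) T [set u] [set v]) ->
  u != v -> u \notin Z -> v \notin Z -> m \notin Z ->
  cond_cov S u v Z = cond_cov S u m Z * cond_cov S v m Z / cond_cov S m m Z.
Proof.
move=> sep uv uZ vZ mZ; have mm := lt0r_neq0 (cond_cov_gt0 pdS mZ).
have [->|um] := eqVneq u m.
  by rewrite (cond_covC pdS v) mulrAC divff ?mul1r.
have [->|vm] := eqVneq v m; first by rewrite mulfK.
apply/eqP; rewrite (cond_covC pdS v) -subr_eq0 -cond_covU1 //.
by rewrite cond_cov_separated ?inE ?negb_or ?um ?vm //; apply/sep/setU11.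
Qed.

(** [A], [B], [C], [D] stand for the conditional variances of a, b, c, m, and [P], [Q], [T] for the
    covariances of a, b, c with m. Conditioning on b multiplies the covariance of a and c by t = 1 -
    y^2, but each variance by at least t. *)
Lemma partial_corr_le (A B C D P Q T : R) :
  0 < A -> 0 < B -> 0 < C -> 0 < D ->
  P ^+ 2 / D <= A -> Q ^+ 2 / D <= B -> T ^+ 2 / D <= C ->
  let A' := A - (P * Q / D) ^+ 2 / B in
  let C' := C - (Q * T / D) ^+ 2 / B in
  0 < A' -> 0 < C' ->
  (P * T / D - (P * Q / D) * (Q * T / D) / B) ^+ 2 / (A' * C') <=
  (P * T / D) ^+ 2 / (A * C).
Proof.
move=> A0 B0 C0 D0 PA QB TC A' C' A'0 C'0.
have B1 := lt0r_neq0 B0; have D1 := lt0r_neq0 D0.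
pose t := 1 - Q ^+ 2 / (D * B).
have t0 : 0 <= t.
  by rewrite subr_ge0 invfM mulrA ler_pdivrMr ?mul1r.
have t1 : 0 <= 1 - t.
  by rewrite subKr divr_ge0 ?sqr_ge0 // mulr_ge0 ?ltW.
have A'E : A' = A - P ^+ 2 / D * (1 - t).
  by rewrite /A' /t; field; rewrite B1 D1.
have C'E : C' = C - T ^+ 2 / D * (1 - t).
  by rewrite /C' /t; field; rewrite B1 D1.
have convex U W : W <= U -> U * t <= U - W * (1 - t).
  move=> WU; rewrite -subr_ge0.
  have -> : U - W * (1 - t) - U * t = (U - W) * (1 - t) by ring.
  by rewrite mulr_ge0 // subr_ge0.
have At : A * t <= A' by rewrite A'E; apply: convex.
have Ct : C * t <= C' by rewrite C'E; apply: convex.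
have -> : P * T / D - P * Q / D * (Q * T / D) / B = P * T / D * t.
  by rewrite /t; field; rewrite B1 D1.
rewrite ler_pdivrMr ?mulr_gt0 // [leRHS]mulrAC ler_pdivlMr ?mulr_gt0 //.
rewrite exprMn -[leLHS]mulrA ler_wpM2l ?sqr_ge0 //.
have -> : t ^+ 2 * (A * C) = (A * t) * (C * t) by ring.
by apply: ler_pM => //; rewrite mulr_ge0 // ltW.
Qed.

Lemma rho2_ge0 u v (Z : {set V}) : 0 <= rho2 S u v Z.
Proof. by rewrite divr_ge0 ?sqr_ge0 // mulr_ge0 ?cond_cov_ge0. Qed.

Lemma rho2_setU1 a b c (Z : {set V}) :
  a != c -> a \notin b |: Z -> c \notin b |: Z ->
  rho2 S a c (b |: Z) <= rho2 S a c Z.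
Proof.
move=> ac abZ cbZ; have [bZ|bZ] := boolP (b \in Z).
  by rewrite (setUidPr _) // sub1set.
have [m sep] := tree_median (edge_tree G) a b c.
have := abZ; rewrite !inE negb_or => /andP[ab aZ].
have := cbZ; rewrite !inE negb_or eq_sym => /andP[bc cZ].
have [mZ|mZ] := boolP (m \in Z).
  have [sab sac sbc] := sep Z mZ.
  rewrite {1}/rho2 cond_covU1 // (cond_cov_separated sac) //.
  rewrite (cond_cov_separated sab) // !mul0r subrr expr0n mul0r.
  exact: rho2_ge0.
have abE := cond_cov_median
  (fun T mT => let: And3 s _ _ := sep T mT in s) ab aZ bZ mZ.
have acE := cond_cov_median
  (fun T mT => let: And3 _ s _ := sep T mT in s) ac aZ cZ mZ.
have bcE := cond_cov_median
  (fun T mT => let: And3 _ _ s := sep T mT in s) bc bZ cZ mZ.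
(* Cauchy-Schwarz, as nonnegativity of the variance left after conditioning on m; u = m is allowed,
   since m may be a, b or c. *)
have le_m u : cond_cov S u m Z ^+ 2 / cond_cov S m m Z <= cond_cov S u u Z.
  have := cond_cov_ge0 pdS u (m |: Z).
  by rewrite cond_covU1 // (cond_covC pdS m u) -expr2 subr_ge0.
have A'0 := cond_cov_gt0 pdS abZ; have C'0 := cond_cov_gt0 pdS cbZ.
move: A'0 C'0; rewrite /rho2 !cond_covU1 // (cond_covC pdS b a).
rewrite (cond_covC pdS c b) -!expr2 abE acE bcE.
by apply: partial_corr_le => //; apply: cond_cov_gt0.
Qed.

Lemma rho2_setU a c (Z W : {set V}) :
  a != c -> a \notin Z :|: W -> c \notin Z :|: W ->
  rho2 S a c (Z :|: W) <= rho2 S a c Z.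
Proof.
move=> ac; have -> : W = [set x in enum W].
  by apply/setP => x; rewrite inE mem_enum.
elim: (enum W) => [|b s IH]; first by rewrite set_nil setU0.
rewrite set_cons setUCA => abW cbW.
apply: le_trans (rho2_setU1 ac abW cbW) (IH _ _).
  by apply: contraNN abW => aW; rewrite inE aW orbT.
by apply: contraNN cbW => cW; rewrite inE cW orbT.
Qed.

End Monotonicity.

Theorem theorem7 (R : realType) (V : finType) (G : gaussian_tree R V)
    (a c : V) (Z1 Z2 : {set V}) :
  a != c ->
  Z1 \subset ~: [set a; c] ->
  Z2 \subset ~: [set a; c] ->
  cond_indep (cov G) [set a; c] Z2 Z1 ->
  rho2 (cov G) a c Z1 <= rho2 (cov G) a c Z2.
Proof.
move=> ac sZ1 sZ2 /cond_indepP ind.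
have pdS := cov_posdef G.
have a2 : a \in [set a; c] by rewrite set21.
have c2 : c \in [set a; c] by rewrite set22.
have notinU x : x \in [set a; c] -> x \notin Z2 :|: Z1.
  apply: contraL; rewrite -in_setC; apply: subsetP.
  by rewrite subUset sZ2.
have -> : rho2 (cov G) a c Z1 = rho2 (cov G) a c (Z2 :|: Z1).
  by rewrite setUC /rho2 !cond_cov_setU // => w; apply: ind.
by apply: rho2_setU => //; apply: notinU.
Qed.
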